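(* Let $n$ be an odd positive integer, written as $n=p_1^{e_1}p_2^{e_2}\cdots p_k^{e_k}$, where $p_1>p_2>\dots>p_k$ are distinct primes and each $e_i$ is a positive integer. Then $n$ is a 2-generated number if and only if $n$ is cube-free and for every pair of indices $i<j$ in $\{1,\dots,k\}$, either $p_j\nmid (p_i-1)$ or $e_i=1$.
   Context: A positive integer $n$ is called a 2-generated number if every group of order $n$ can be generated by two elements (not necessarily distinct), i.e. every group $G$ of order $n$ satisfies $d(G)\le 2$, where $d(G)$ is the minimum size of a generating set of $G$. A positive integer is cube-free if it is not divisible by $p^3$ for any prime $p$. *)

(* Defs.v *)
From mathcomp Require Import all_boot all_fingroup all_solvable.

Set Implicit Arguments.
Unset Strict Implicit.
Unset Printing Implicit Defensive.

Local Open Scope group_scope.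

Definition two_generated_number (n : nat) : Prop :=
  0 < n /\
  forall (gT : finGroupType) (G : {group gT}), #|G| = n -> 'm(G) <= 2.

(* The bound on the generator rank is generation by two elements that need
   not be distinct. *)
Lemma grank_le2P (gT : finGroupType) (G : {group gT}) :
  'm(G) <= 2 <-> exists x y : gT, <<[set x; y]>> = G.
Proof.
split=> [|[x [y <-]]]; last first.
  by apply: leq_trans (grank_min _) _; rewrite cards2; case: eqP.
have [B defG <-] := grank_witness G.
case: (ltngtP #|B| 2) => // [ltB2 _|/eqP/cards2P[x [y [_ defB]]] _]; last first.
  by exists x, y; rewrite -defG defB.
case: (posnP #|B|) => [/eqP|B_gt0].
  rewrite cards_eq0 => /eqP B0; exists 1, 1.
  by rewrite -defG B0 setUid gen0 gen_set_id // group_set_one.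
have /eqP/cards1P[x defB] : #|B| = 1%N by apply/eqP; rewrite eqn_leq -ltnS ltB2.
by exists x, x; rewrite setUid -defG defB.
Qed.

Definition cube_free (n : nat) : Prop :=
  forall q : nat, prime q -> ~~ (q ^ 3 %| n)%N.

(* Main.v *)
Require Import Defs.
From mathcomp Require Import all_boot all_fingroup all_solvable.
From mathcomp Require Import all_algebra mxabelem.

(** For odd n, both conditions of the theorem are equivalent to a condition
    [gen2_criterion] that does not mention a factorisation: n is cube-free, and
    no prime divisor of n divides p - 1 when p ^ 2 divides n.

    Necessity.  A group of order m with m | n that needs three generators,
    times a cyclic group of order n / m, is a group of order n that still needs
    three.  If q ^ 3 | n, take the elementary abelian group of order q ^ 3.  If
    p ^ 2 | n, r | n and r | p - 1, let a scalar of order r in 'F_p act on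
    'rV['F_p]_2.  If two elements generated this extension G of V by <[c]>, one
    could be moved into V by multiplying it by a power of the other; its span is
    normal, because every subgroup of V is, and the quotient is cyclic, so it
    contains the derived subgroup, which is V.  But V is not cyclic
    ([scalar_extension_not_gen2]).

    Sufficiency.  The criterion passes to divisors, so one can induct on #|G|.
    - A group of odd cube-free order has a normal Sylow p-subgroup P for its
      largest prime p ([Sylow_largest_prime_normal]).  For the smallest prime q,
      a Sylow q-subgroup Q is centralised by its normaliser, because a nontrivial
      action of an r-group on Q, with r > q prime, forces r | q ^ 2 - 1, hence
      r = q + 1, which is impossible for odd r and q.  Burnside's transfer theorem
      then gives a normal q-complement, and one descends.
    - G / P is generated by two elements by induction.  If P is minimal normal
      in G, generators of G / P lift to generators of G
      ([gen2_lift_coprime_minnormal]): otherwise the #|P| ^ 2 pairs of lifts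
      generate distinct complements of P, but a complement has at most #|P|
      conjugates, and all complements are conjugate.
    - If P is not minimal normal, then P has order p ^ 2 and has a G-invariant
      subgroup of order p.  The criterion leaves no room for an action of a
      p'-element on a factor of order p, so P is central and G is the direct
      product of P and a p'-group ([reducible_Sylow_central]).  Two groups of
      coprime orders generated by two elements each have a direct product
      generated by two elements. *)

Set Implicit Arguments.
Unset Strict Implicit.
Unset Printing Implicit Defensive.

Import GRing.Theory FinRing.Theory.
Local Open Scope group_scope.

(** * Transfer into an abelian Sylow subgroup *)

(** Burnside's fusion argument: if g and g ^ x lie in S, then S and S :^ x are
    both Sylow subgroups of the centraliser of g ^ x, and an element of this
    centraliser that conjugates one into the other corrects x. *)
Lemma Sylow_abelian_fusion p (gT : finGroupType) (G S : {group gT}) x g :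
    p.-Sylow(G) S -> abelian S -> x \in G -> g \in S -> g ^ x \in S ->
  exists2 y, y \in 'N_G(S) & g ^ x = g ^ y.
Proof.
move=> sylS abS Gx Sg Sgx; have sSG := pHall_sub sylS.
have sCG: 'C_G[g ^ x] \subset G := subsetIl _ _.
have sylSx: p.-Sylow('C_G[g ^ x]) (S :^ x)%G.
  have sylSxG: p.-Sylow(G) (S :^ x)%G by rewrite pHallJ.
  apply: pHall_subl (sylSxG) => //.
  by rewrite subsetI (pHall_sub sylSxG) sub_cent1 centJ memJ_conjg (subsetP abS).
have sylS': p.-Sylow('C_G[g ^ x]) S.
  by apply: pHall_subl (sylS); rewrite // subsetI sSG sub_cent1 (subsetP abS).
have [c /setIP[Gc /cent1P cgc] /= defS] := Sylow_trans sylSx sylS'.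
exists (x * c); first by rewrite !inE groupM //= conjsgM -defS.
by rewrite conjgM; apply/esym/conjg_fixP/commgP; apply: commute_sym.
Qed.

(** The transfer of g is a product of G-conjugates, lying in S, of powers of g
    whose exponents add up to #|G : S|.  By fusion these conjugates are conjugates
    under the normaliser of S, which fixes S pointwise. *)
Lemma transfer_Sylow_id p (gT : finGroupType) (G S : {group gT})
    (sSG : S \subset G) (abS : abelian (idm S @* S)) :
    p.-Sylow(G) S -> 'N_G(S) \subset 'C(S) ->
  {in S, forall g, val (transfer G abS g) = g ^+ #|G : S|}.
Proof.
move=> sylS cNS g Sg; have Gg := subsetP sSG g Sg.
have cSS : abelian S by apply: subset_trans cNS; rewrite subsetI sSG normG.
have trX := transversalP (rcosets_cycle_partition sSG Gg).
rewrite (transfer_cycle_expansion sSG _ Gg trX) /= FiniteModule.fmval_sum.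
rewrite -(sum_index_rcosets_cycle sSG Gg trX).
rewrite (big_morph (fun n => g ^+ n) (expgD g) (erefl : g ^+ 0 = 1)).
apply: eq_bigr => x Xx.
have Gx : x \in G by apply: (subsetP (transversal_sub trX)).
have Sgx : (g ^+ #|<[g]> : S :* x|) ^ x^-1 \in S.
  have := mulg_exp_card_rcosets S g x.
  by rewrite mem_rcoset conjgE invgK mulgA.
have [||y /setIP[Gy Ny] ->] := Sylow_abelian_fusion sylS cSS _ _ Sgx.
- by rewrite groupV.
- by rewrite groupX.
have /conjg_fixP-> : [~ g ^+ #|<[g]> : S :* x|, y] == 1.
  apply/commgP; apply: commute_sym; apply: (centP (subsetP cNS y _)).
    exact/setIP.
  exact: groupX.
rewrite /restrm /= FiniteModule.fmodK //=.
by rewrite -[X in X \in _]/(idm S _) mem_morphim ?groupX.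
Qed.

(** The complement is the kernel of the transfer: on S the transfer is the
    #|G : S|-th power map, which is injective since #|G : S| is prime to #|S|,
    and its values lie in a copy of S. *)
Theorem Burnside_normal_complement p (gT : finGroupType) (G S : {group gT}) :
    p.-Sylow(G) S -> 'N_G(S) \subset 'C(S) ->
  exists2 K : {group gT}, K <| G & p^'.-Hall(G) K.
Proof.
move=> sylS cNS; have sSG := pHall_sub sylS.
have cSS : abelian S by apply: subset_trans cNS; rewrite subsetI sSG normG.
have abS : abelian (idm S @* S) by rewrite morphim_idm.
pose K := ('ker (transfer_morphism G abS))%G.
have nsKG : K <| G := ker_normal _.
exists K => //.
have tiKS : K :&: S = 1.
  apply/trivgP/subsetP=> g /setIP[/mker/= trg1 Sg].
  have := transfer_Sylow_id sSG abS sylS cNS Sg.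
  rewrite trg1 /= => /esym gn1.
  have coSG : coprime #|S| #|G : S|.
    by case/and3P: sylS => _ pS p'GS; apply: pnat_coprime pS p'GS.
  by rewrite inE -(expgK coSG Sg) gn1 expg1n.
have leGK : #|G : K| <= #|S|.
  rewrite -{1}(setIid G) -(card_morphim (transfer_morphism G abS)).
  apply: leq_trans (max_card _) _; rewrite card_sub.
  have/subset_leq_card/leq_trans-> // : [pred x in (idm S @* S)] \subset S.
  by apply/subsetP=> x; rewrite inE morphim_idm.
have oG : #|K * S| = #|G|.
  apply/eqP; rewrite eqn_leq subset_leq_card; last first.
    by rewrite mul_subG ?(normal_sub nsKG).
  by rewrite /= TI_cardMg // -(Lagrange (normal_sub nsKG)) leq_mul2l leGK orbT.
apply/pHallP; split; first exact: normal_sub.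
apply/eqP; rewrite -(eqn_pmul2r (cardG_gt0 S)) -TI_cardMg // oG.
by rewrite (card_Hall sylS) mulnC partnC.
Qed.

(** * Coprime actions on groups of order dividing the square of a prime *)

(** Orbit counting; it replaces the computation of the automorphism group of Q
    by a congruence for the index of the fixed points. *)
Lemma index_cent_pgroup_mod r (gT : finGroupType) (R Q : {group gT}) :
    prime r -> r.-group R -> r^'.-group Q -> R \subset 'N(Q) ->
  #|Q : 'C_Q(R)| = 1 %[mod r].
Proof.
move=> r_pr rR r'Q nQR.
have := pgroup_fix_mod (to := 'J) rR (S := Q).
rewrite afixJ astabsJ => /(_ nQR).
have coCr : coprime r #|'C_Q(R)|.
  by rewrite prime_coprime // -p'natE //; apply: pgroupS r'Q; apply: subsetIl.
rewrite -{1}(Lagrange (subsetIl Q 'C(R))) -{2}[#|_|]muln1 => /eqP.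
rewrite eqn_mod_dvd ?leq_pmul2l // -mulnBr Gauss_dvdr // -eqn_mod_dvd //.
by move/eqP.
Qed.

Lemma dvd_prime_mod_eq1 p r d :
  prime p -> ~~ (r %| p - 1)%N -> d %| p -> d = 1 %[mod r] -> d = 1%N.
Proof.
move=> p_pr ndv /(primeP p_pr).2 /orP[/eqP-> // | /eqP->] /eqP.
by rewrite eqn_mod_dvd ?prime_gt0 // (negPf ndv).
Qed.

Lemma pgroup_card_dvd_sq p (gT : finGroupType) (P : {group gT}) :
  prime p -> #|P| %| p ^ 2 -> p.-group P.
Proof. by move=> p_pr oP; rewrite /pgroup (pnat_dvd oP) // pnatX pnat_id. Qed.

Lemma abelian_gen2_card_dvd_sq p (gT : finGroupType) (P : {group gT}) :
  prime p -> #|P| %| p ^ 2 -> abelian P /\ 'm(P) <= 2.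
Proof.
move=> p_pr oP; have pP := pgroup_card_dvd_sq p_pr oP.
have le2 : logn p #|P| <= 2.
  by rewrite (leq_trans (dvdn_leq_log p _ oP)) ?expn_gt0 ?prime_gt0 ?pfactorK.
have cPP := p2group_abelian pP le2; split=> //.
by rewrite grank_abelian // (rank_pgroup pP) (leq_trans (p_rank_le_logn _ _)).
Qed.

Lemma card_Sylow_cube_free q (gT : finGroupType) (G S : {group gT}) :
  prime q -> ~~ (q ^ 3 %| #|G|)%N -> q.-Sylow(G) S -> #|S| %| q ^ 2.
Proof.
move=> q_pr; rewrite pfactor_dvdn // -leqNgt => le2 /card_Hall->.
by rewrite p_part dvdn_exp2l.
Qed.

Lemma card_proper_chain_dvd_sq p (gT : finGroupType) (P M : {group gT}) :
    prime p -> #|P| %| p ^ 2 -> M \subset P -> M :!=: 1 -> M :!=: P ->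
  #|M| = p /\ #|P| = (p ^ 2)%N.
Proof.
move=> p_pr oP sMP ntM neMP.
have ltMP : #|M| < #|P| by rewrite proper_card // properEneq neMP.
have gtM : 1 < #|M| by rewrite cardG_gt1.
have p_gt1 := prime_gt1 p_pr.
have /(dvdn_pfactor _ _ p_pr)[i le_i2 oPi] := oP.
have /(dvdn_pfactor _ _ p_pr)[j le_ji oMj] : #|M| %| p ^ i.
  by rewrite -oPi cardSg.
move: gtM ltMP; rewrite oPi oMj -{1}(expn0 p) !ltn_exp2l //.
by case: i j le_i2 {le_ji oPi oMj} => [|[|[|]]] // [|[|]].
Qed.

(** R centralises M since #|M : 'C_M(R)| is 1 or p and is congruent to 1 modulo
    r.  Then 'C_P(R) contains M, so #|P : 'C_P(R)| is again 1 or p. *)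
Lemma reducible_Sylow_central p (gT : finGroupType) (P M R : {group gT}) r :
    prime p -> M \subset P -> #|M| = p -> #|P| = (p ^ 2)%N ->
    R \subset 'N(M) -> R \subset 'N(P) ->
    prime r -> r.-group R -> r != p -> ~~ (r %| p - 1)%N ->
  R \subset 'C(P).
Proof.
move=> p_pr sMP oM oP nMR nPR r_pr rR neq_rp ndv.
have pP : p.-group P by rewrite /pgroup oP pnatX pnat_id.
have r'P : r^'.-group P by apply: pi_pgroup pP _; rewrite !inE eq_sym.
have r'M := pgroupS sMP r'P.
have dvPM : #|P : M| %| p.
  by rewrite -(dvdn_pmul2l (cardG_gt0 M)) Lagrange // oM oP.
have dvMC : #|M : 'C_M(R)| %| p by rewrite -oM dvdn_indexg.
have cMR : M \subset 'C(R).
  have modM := index_cent_pgroup_mod r_pr rR r'M nMR.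
  have /eqP := dvd_prime_mod_eq1 p_pr ndv dvMC modM.
  by rewrite indexg_eq1 subsetI subxx.
rewrite centsC; have dvPC : #|P : 'C_P(R)| %| p.
  by apply: dvdn_trans dvPM; apply: indexgS; rewrite subsetI sMP.
have modP := index_cent_pgroup_mod r_pr rR r'P nPR.
have /eqP := dvd_prime_mod_eq1 p_pr ndv dvPC modP.
by rewrite indexg_eq1 subsetI subxx.
Qed.

(** * The Sylow subgroup for the largest prime *)

Lemma smallest_Sylow_centralises_norm q (gT : finGroupType)
    (G S : {group gT}) :
    odd #|G| -> prime q -> q.-Sylow(G) S -> #|S| %| q ^ 2 ->
    (forall r, prime r -> r %| #|G| -> q <= r) ->
  'N_G(S) \subset 'C(S).
Proof.
move=> oddG q_pr sylS oS minq; have [sSG qS _] := and3P sylS.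
have [cSS _] := abelian_gen2_card_dvd_sq q_pr oS.
have <- : _ = 'N_G(S) := Sylow_gen _.
rewrite gen_subG; apply/bigcupsP=> R /SylowP[r r_pr sylR].
have [sRN rR _] := and3P sylR; have /subsetIP[sRG nSR] := sRN.
have [eq_rq | neq_rq] := eqVneq r q.
  apply: subset_trans cSS; rewrite eq_rq in rR.
  have sylSN : q.-Sylow('N_G(S)) S by rewrite Sylow_subnorm.
  by rewrite (sub_normal_Hall sylSN) ?normal_subnorm.
have [-> | ntR] := eqVneq R 1%G; first by rewrite sub1G.
have rG : r %| #|G|.
  by apply: dvdn_trans (cardSg sRG); have [] := pgroup_pdiv rR ntR.
have ltqr : q < r by rewrite ltn_neqAle eq_sym neq_rq minq.
have r'S : r^'.-group S by apply: pi_pgroup qS _; rewrite !inE eq_sym.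
have /eqP := index_cent_pgroup_mod r_pr rR r'S nSR.
rewrite eqn_mod_dvd ?indexg_gt0 //.
have /(dvdn_pfactor _ _ q_pr)[i lei2 oi] : #|S : 'C_S(R)| %| q ^ 2.
  by apply: dvdn_trans oS; apply: dvdn_indexg.
case: (posnP i) => [i0 | i_gt0].
  have: #|S : 'C_S(R)| == 1%N by rewrite oi i0.
  by rewrite indexg_eq1 subsetI centsC => /andP[].
have qG : q %| #|G|.
  apply: dvdn_trans (cardSg sSG); apply: dvdn_trans (dvdn_indexg S 'C_S(R)).
  by rewrite oi dvdn_exp.
have odd_q : odd q := dvdn_odd qG oddG.
have odd_r : odd r := dvdn_odd rG oddG.
rewrite oi => r_dv.
have {r_dv} : r %| ((q - 1) * (q + 1))%N.
  case: i i_gt0 lei2 r_dv {oi} => [|[|[|]]] // _ _ r_dv; first exact: dvdn_mulr.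
  by rewrite -subn_sqr exp1n.
(* As r > q, the only way out is r = q + 1, which has the wrong parity. *)
rewrite Euclid_dvdM // => /orP[] /dvdn_leq.
  rewrite subn_gt0 prime_gt1 // leqNgt (leq_ltn_trans (leq_subr 1 q)) //.
  by move/(_ isT).
rewrite addn1 => /(_ isT); rewrite leq_eqVlt ltnNge ltqr orbF => /eqP eq_rq.
by rewrite eq_rq /= odd_q in odd_r.
Qed.

(** Descending to a normal complement for the smallest prime divisor leaves the
    Sylow p-subgroup in place; it is characteristic in the complement. *)
Lemma Sylow_largest_prime_normal p (gT : finGroupType) (G : {group gT}) :
    odd #|G| -> cube_free #|G| -> prime p ->
    (forall r, prime r -> r %| #|G| -> r <= p) ->
  p.-Sylow(G) 'O_p(G).
Proof.
have [n] := ubnP #|G|; elim: n => // n IHn in G *; rewrite ltnS => leGn.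
move=> oddG cfG p_pr maxp.
have [pG | ] := boolP (p.-group G).
  by rewrite pcore_pgroup_id // pHallE subxx /= part_pnat_id.
have [-> | ntG pn] := eqVneq G 1%G; first by rewrite /pgroup cards1.
have gtG1 : 1 < #|G| by rewrite cardG_gt1.
pose q := pdiv #|G|.
have q_pr : prime q := pdiv_prime gtG1.
have qG : q %| #|G| := pdiv_dvd _.
have minq r : prime r -> r %| #|G| -> q <= r.
  by move=> /prime_gt1; apply: pdiv_min_dvd.
have neq_pq : p != q.
  apply: contraNneq pn => eq_pq; apply/pgroupP=> r r_pr rG.
  by rewrite !inE eqn_leq maxp //= eq_pq minq.
have [S sylS] := Sylow_exists q G.
have oS := card_Sylow_cube_free q_pr (cfG q q_pr) sylS.
have cNS := smallest_Sylow_centralises_norm oddG q_pr sylS oS minq.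
have [K nsKG hallK] := Burnside_normal_complement sylS cNS.
have sKG := normal_sub nsKG.
have dvK : #|K| %| #|G| := cardSg sKG.
have ltKG : #|K| < #|G|.
  rewrite ltn_neqAle dvdn_leq // andbT; apply/eqP=> eqKG.
  have /and3P[_ /pgroupP/(_ q q_pr)] := hallK.
  by rewrite eqKG => /(_ qG); rewrite !inE eqxx.
have sylK : p.-Sylow(K) 'O_p(K).
  apply: IHn => //; first exact: leq_trans ltKG leGn.
  - exact: dvdn_odd dvK oddG.
  - by move=> r r_pr; apply: contra (cfG r r_pr) => /dvdn_trans->.
  by move=> r r_pr rK; apply: maxp => //; apply: dvdn_trans dvK.
have sylG : p.-Sylow(G) 'O_p(K).
  by apply: subHall_Sylow hallK _ sylK; rewrite !inE.
by rewrite (normal_Hall_pcore sylG) ?gFnormal_trans.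
Qed.

(** * Lifting pairs of generators *)

(** Suppose that no lifts u, v of two generators of G / M generate G.  Since M
    is minimal normal and abelian, <<[set u; v]>> then meets M trivially, so it
    is a complement of M and, by Schur-Zassenhaus, a conjugate by some m in M of
    the complement generated by one fixed pair of lifts x, y.  A complement
    contains only one element of each coset of M, so u = x ^ m and v = y ^ m.
    Hence M maps onto the #|M| ^ 2 pairs of lifts, which is absurd. *)
Lemma gen2_lift_coprime_minnormal (gT : finGroupType) (G M : {group gT}) :
    minnormal M G -> M \subset G -> abelian M -> coprime #|M| #|G : M| ->
  'm(G / M) <= 2 -> 'm(G) <= 2.
Proof.
case/mingroupP=> /andP[ntM nMG] minM sMG abM coM /grank_le2P[X [Y genXY]].
have nsMG : M <| G by apply/andP.
have lift Z : Z \in G / M -> exists2 z, z \in G & Z = coset M z.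
  by case/morphimP=> z _ Gz ->; exists z.
have [|x Gx defX] := lift X; first by rewrite -genXY mem_gen ?set21.
have [|y Gy defY] := lift Y; first by rewrite -genXY mem_gen ?set22.
have [Nx Ny] : x \in 'N(M) /\ y \in 'N(M) by rewrite !(subsetP nMG).
have genG u v : u \in M :* x -> v \in M :* y ->
    <<[set u; v]>> \subset G /\ M * <<[set u; v]>> = G.
  move=> Mxu Myv.
  have [Gu Gv] : u \in G /\ v \in G.
    by split; [apply: subsetP Mxu | apply: subsetP Myv];
       rewrite mul_subG // sub1set.
  have sKG : <<[set u; v]>> \subset G.
    by rewrite gen_subG; apply/subsetP=> z /set2P[]->.
  split=> //; rewrite -quotientK ?(subset_trans sKG) //.
  have nMuv : [set u; v] \subset 'N(M).
    by rewrite (subset_trans _ nMG) // -gen_subG.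
  have [Nu Nv] : u \in 'N(M) /\ v \in 'N(M) by rewrite !(subsetP nMG).
  rewrite quotient_gen // quotientU !quotient_set1 //.
  rewrite (rcoset_kercosetP Nu Nx Mxu) (rcoset_kercosetP Nv Ny Myv).
  by rewrite -defX -defY genXY quotientGK.
pose gens u v := [&& u \in M :* x, v \in M :* y & <<[set u; v]>> == G].
have [/existsP[u /existsP[v /and3P[_ _ /eqP genuv]]] | /existsPn noG] :=
  boolP [exists u, exists v, gens u v].
  by apply/grank_le2P; exists u, v.
have tiM u v : u \in M :* x -> v \in M :* y -> M :&: <<[set u; v]>> = 1.
  move=> Mxu Myv; have [sKG defG] := genG u v Mxu Myv.
  apply/eqP; apply: contraT => ntMK.
  have nMK : G \subset 'N(M :&: <<[set u; v]>>).
    rewrite -{1}defG mulG_subG cents_norm ?(sub_abelian_cent abM) ?subsetIl //=.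
    by rewrite normsI ?normG // (subset_trans sKG).
  have := minM (M :&: <<[set u; v]>>)%G.
  rewrite ntMK nMK subsetIl => /(_ isT isT)/setIidPl sMK.
  have /existsPn/(_ v) := noG u.
  by rewrite /gens Mxu Myv /= -[X in _ == X]defG => /eqP[]; rewrite mulSGid.
have oK u v : u \in M :* x -> v \in M :* y -> #|<<[set u; v]>>| = #|G : M|.
  move=> Mxu Myv; have [sKG defG] := genG u v Mxu Myv.
  apply/eqP; rewrite -(eqn_pmul2l (cardG_gt0 M)) -TI_cardMg ?tiM // defG.
  by rewrite Lagrange.
have [sK0G defG0] := genG x y (rcoset_refl M x) (rcoset_refl M y).
have conj_all : setX (M :* x) (M :* y) \subset [set (x ^ m, y ^ m) | m in M].
  apply/subsetP=> -[u v] /setXP[/= Mxu Myv].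
  have [sKG defG] := genG u v Mxu Myv.
  have [|||||m Mm /= defK] :=
    @SchurZassenhaus_trans_sol _ M <<[set x; y]>> <<[set u; v]>>.
  - exact: abelian_sol.
  - exact: subset_trans nMG.
  - by rewrite defG0.
  - by rewrite oK ?rcoset_refl.
  - by rewrite !oK ?rcoset_refl.
  have conj_eq z w : z \in G -> z \in <<[set x; y]>> -> w \in M :* z ->
    w \in <<[set u; v]>> -> w = z ^ m.
  - move=> Gz Kz Mzw Kw; apply/eqP.
    rewrite eq_mulgV1 -in_set1 -[[set 1]](tiM u v) // inE.
    have Kzm : z ^ m \in <<[set u; v]>>.
      by move: (Kz); rewrite -(memJ_conjg _ m) -defK.
    rewrite (groupM Kw) ?groupV ?andbT //.
    have [Nz Nm] : z \in 'N(M) /\ m \in 'N(M).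
      by rewrite !(subsetP nMG) // (subsetP sMG).
    have Nw : w \in 'N(M) by rewrite (subsetP nMG) // (subsetP sKG).
    rewrite -mem_rcoset; apply/rcoset_kercosetP; rewrite ?groupJ //.
    rewrite morphJ //= (coset_id Mm) conjg1.
    exact/rcoset_kercosetP.
  apply/imsetP; exists m => //.
  by congr (_, _); apply: conj_eq; rewrite ?mem_gen ?set21 ?set22.
have := leq_trans (subset_leq_card conj_all) (leq_imset_card _ _).
rewrite cardsX !card_rcoset -{3}[#|M|]muln1 leq_pmul2l // leqNgt.
by rewrite cardG_gt1 ntM.
Qed.

(** The products a * x and b * y of corresponding generators suffice: the
    factors of coprime orders are powers of the product. *)
Lemma gen2_dprod_coprime (gT : finGroupType) (G H K : {group gT}) :
    H \x K = G -> coprime #|H| #|K| -> 'm(H) <= 2 -> 'm(K) <= 2 ->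
  'm(G) <= 2.
Proof.
move=> defG coHK /grank_le2P[a [b genH]] /grank_le2P[x [y genK]].
have [_ defHK cHK _] := dprodP defG.
have [Ha Hb] : a \in H /\ b \in H by rewrite -genH !mem_gen ?set21 ?set22.
have [Kx Ky] : x \in K /\ y \in K by rewrite -genK !mem_gen ?set21 ?set22.
have factors h k : h \in H -> k \in K -> h \in <[h * k]> /\ k \in <[h * k]>.
  move=> Hh Kk; rewrite cycleM.
  - by split; [apply: (subsetP (mulG_subl _ _)) |
               apply: (subsetP (mulG_subr _ _))]; apply: cycle_id.
  - by apply: commute_sym; apply: (centsP cHK).
  by apply: coprime_dvdl (coprime_dvdr _ coHK); apply: order_dvdG.
apply/grank_le2P; exists (a * x), (b * y); apply/eqP.
rewrite eqEsubset gen_subG; apply/andP; split.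
  by rewrite -defHK; apply/subsetP=> _ /set2P[]->; apply: mem_mulg.
have sub z : z \in [set a * x; b * y] -> <[z]> \subset <<[set a * x; b * y]>>.
  by move=> zP; rewrite cycle_subG mem_gen.
have /subsetP sax := sub _ (set21 _ _); have /subsetP sby := sub _ (set22 _ _).
have [ax1 ax2] := factors _ _ Ha Kx; have [by1 by2] := factors _ _ Hb Ky.
rewrite -defHK mul_subG // -?genH -?genK gen_subG; apply/subsetP=> _ /set2P[]->.
- exact: sax.
- exact: sby.
- exact: sax.
exact: sby.
Qed.

(** * Sufficiency *)

(** Unlike the condition on the pairs of indices of a factorisation, this form
    visibly passes to divisors, hence to quotients.  The order of the primes is
    implicit in it: r | p - 1 gives r < p. *)
Definition gen2_criterion n :=
  [/\ odd n, cube_free n &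
      forall p r, prime p -> prime r -> p ^ 2 %| n -> r %| n ->
        ~~ (r %| p - 1)%N].

Lemma gen2_criterion_dvd m n : m %| n -> gen2_criterion n -> gen2_criterion m.
Proof.
move=> dv_mn [oddn cfn actn]; split; first exact: dvdn_odd dv_mn oddn.
  by move=> q /cfn; apply: contra => /dvdn_trans->.
move=> p r p_pr r_pr p2m rm.
by apply: actn; rewrite // (dvdn_trans _ dv_mn).
Qed.

Lemma gen2_criterion_gen2 (gT : finGroupType) (G : {group gT}) :
  gen2_criterion #|G| -> 'm(G) <= 2.
Proof.
have [n] := ubnP #|G|; elim: n => // n IHn in gT G *.
rewrite ltnS => leGn critG; have [oddG cfG actG] := critG.
have [-> | ntG] := eqVneq G 1%G.
  by apply/grank_le2P; exists 1, 1; rewrite setUid; apply: genGid 1%G.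
have gtG1 : 1 < #|G| by rewrite cardG_gt1.
pose p := max_pdiv #|G|; have p_pr : prime p := max_pdiv_prime gtG1.
have pG : p %| #|G| := max_pdiv_dvd _.
have maxp r : prime r -> r %| #|G| -> r <= p.
  by move=> r_pr rG; apply: max_pdiv_max; rewrite mem_primes r_pr cardG_gt0.
have sylP := Sylow_largest_prime_normal oddG cfG p_pr maxp.
set P := 'O_p(G)%G; have nsPG : P <| G := pcore_normal _ _.
have [sPG nPG] := andP nsPG.
have oP := card_Sylow_cube_free p_pr (cfG p p_pr) sylP.
have ntP : P :!=: 1.
  by rewrite -cardG_gt1 (card_Hall sylP) p_part_gt1 mem_primes p_pr cardG_gt0.
have [cPP genP] := abelian_gen2_card_dvd_sq p_pr oP.
have coP : coprime #|P| #|G : P|.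
  by have [_ pP p'GP] := and3P sylP; apply: pnat_coprime pP p'GP.
have genQ : 'm(G / P) <= 2.
  apply: IHn; first exact: leq_trans (ltn_quotient ntP sPG) leGn.
  by apply: gen2_criterion_dvd critG; rewrite card_quotient ?dvdn_indexg.
have [minP | ] := boolP (minnormal P G).
  exact: gen2_lift_coprime_minnormal minP sPG cPP coP genQ.
have [M minM sMP] := minnormal_exists ntP nPG => notminP.
have [ntM nMG] := andP (mingroupp minM).
have ltMP : M :!=: P.
  by apply: contraNneq notminP => eqMP; rewrite -(group_inj eqMP).
have [oM oP2] := card_proper_chain_dvd_sq p_pr oP sMP ntM ltMP.
have p2G : (p ^ 2 %| #|G|)%N by rewrite -oP2 cardSg.
have hallP : Hall G P by rewrite /Hall sPG.
have [H /complP[tiPH defG]] := splitsP (SchurZassenhaus_split hallP nsPG).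
have sHG : H \subset G by rewrite -defG mulG_subr.
have oH : #|H| = #|G : P|.
  apply/eqP; rewrite -(eqn_pmul2l (cardG_gt0 P)) Lagrange //.
  by rewrite -defG TI_cardMg.
have cHP : H \subset 'C(P).
  rewrite -(Sylow_gen H) gen_subG; apply/bigcupsP=> R /SylowP[r r_pr sylR].
  have [sRH rR _] := and3P sylR; have sRG := subset_trans sRH sHG.
  have [-> | ntR] := eqVneq R 1%G; first by rewrite sub1G.
  have rH : r %| #|H|.
    by apply: dvdn_trans (cardSg sRH); have [] := pgroup_pdiv rR ntR.
  apply: (reducible_Sylow_central p_pr sMP oM oP2 _ _ r_pr rR) => //.
  - exact: subset_trans nMG.
  - exact: subset_trans nPG.
  - apply: contraTneq rH => ->; rewrite -prime_coprime // oH.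
    by apply: coprime_dvdl coP; rewrite oP2 dvdn_exp.
  exact: actG p2G (dvdn_trans rH (cardSg sHG)).
have defGd : P \x H = G by rewrite dprodE.
apply: (gen2_dprod_coprime defGd _ genP); first by rewrite oH.
by rewrite (isog_grank (sdprod_isog (dprodWsd defGd))).
Qed.

(** * Groups that need three generators *)

(** The direct product with a cyclic group of order n / #|A| has order n and
    maps onto A. *)
Lemma two_generated_gen2_dvd n (aT : finGroupType) (A : {group aT}) :
  two_generated_number n -> #|A| %| n -> 'm(A) <= 2.
Proof.
move=> [n_gt0 gen2] dvAn; pose m := n %/ #|A|.
have m_gt0 : 0 < m by rewrite divn_gt0; [apply: dvdn_leq | apply: cardG_gt0].
(* Only 'I_m with m a successor carries a group structure. *)
have oX : #|setX A [set: 'I_m.-1.+1]| = n.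
  rewrite cardsX cardsT card_ord prednK //.
  by rewrite mulnC divnK.
rewrite -{1}(morphim_fstX A [set: 'I_m.-1.+1]%G).
by apply: leq_trans (morphim_grank _ _) (gen2 _ _ oX); apply: subsetT.
Qed.

Lemma two_generated_cube_free n : two_generated_number n -> cube_free n.
Proof.
move=> gen2 q q_pr; apply/negP => q3n.
have abelV := mx_Fp_abelem 1 3 q_pr.
have oV : #|[set: 'rV['F_q]_3]| = (q ^ 3)%N by rewrite cardsT card_mx card_Fp.
have : 'm([set: 'rV['F_q]_3]) <= 2.
  apply: (two_generated_gen2_dvd (A := [set: 'rV['F_q]_3]%G) gen2).
  by rewrite oV.
rewrite (grank_abelian (abelem_abelian abelV)) (rank_abelem abelV).
by rewrite /= oV pfactorK.
Qed.

(** Of two generators one, x, lies outside V, so V * <[x]> = G and the other is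
    v * x ^+ i with v in V.  The span of v is normal and G / <[v]> is generated
    by the image of x, hence abelian: V is inside the derived subgroup, hence
    inside <[v]>. *)
Lemma gen2_cyclic_prime_index (gT : finGroupType) (G V : {group gT}) :
    V <| G -> prime #|G : V| -> V \subset G^`(1) ->
    {in V, forall v, G \subset 'N(<[v]>)} ->
  'm(G) <= 2 -> cyclic V.
Proof.
move=> nsVG prV sVG' nVG /grank_le2P[x0 [y0 genG0]].
have sVG := normal_sub nsVG.
have [x [y [nVx genG]]] : exists x y, x \notin V /\ <<[set x; y]>> = G.
  have [Vx | nVx] := boolP (x0 \in V); last by exists x0, y0.
  exists y0, x0; split; last by rewrite setUC.
  apply: contraL prV => Vy; suff -> : G = V by rewrite indexgg.
  apply/group_inj/eqP; rewrite eqEsubset sVG andbT -genG0 gen_subG.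
  by apply/subsetP=> _ /set2P[]->.
have [Gx Gy] : x \in G /\ y \in G by rewrite -genG !mem_gen ?set21 ?set22.
have defG : V * <[x]> = G.
  by apply: mulg_normal_maximal; rewrite ?p_index_maximal ?cycle_subG.
have /mulsgP[v _ Vv /cycleP[i ->] defy] : y \in V * <[x]> by rewrite defG.
have nvx : <[x]> \subset 'N(<[v]>) by rewrite cycle_subG (subsetP (nVG v Vv)).
have defGv : <[v]> * <[x]> = G.
  apply/eqP.
  rewrite eqEsubset mul_subG ?cycle_subG ?(subsetP sVG v Vv) //=.
  rewrite -norm_joinEr // -genG gen_subG; apply/subsetP=> _ /set2P[]->.
    by rewrite mem_gen // inE cycle_id orbT.
  by rewrite defy groupM ?groupX ?mem_gen // inE cycle_id ?orbT.
apply: cyclicS (cycle_cyclic v); apply: subset_trans sVG' _.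
apply: der1_min (nVG v Vv) _.
by rewrite -defGv quotientMidl quotient_abelian ?cycle_abelian.
Qed.

(** The group is 'rV['F_p]_2 extended by a scalar u of order q.  A scalar acts on
    V as a power map, so it normalises every subgroup of V; and u - 1 is
    invertible, so every element of V is a commutator with u. *)
Lemma scalar_extension_not_gen2 p q :
    prime p -> prime q -> q %| (p - 1)%N ->
  exists (gT : finGroupType) (G : {group gT}),
    #|G| = (p ^ 2 * q)%N /\ ~~ ('m(G) <= 2).
Proof.
move=> p_pr q_pr qp.
pose F := 'F_p; pose to := scale_groupAction F 1 2.
have qU : q %| #|[set: {unit F}]|.
  by rewrite card_finField_unit card_Fp // -subn1.
have [u _ ou] := Cauchy q_pr qU.
pose V := (sdpair1 to @* setT)%G; pose C := (sdpair2 to @* <[u]>)%G.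
have nVC : C \subset 'N(V).
  apply: subset_trans (im_sdpair_norm to).
  by apply: morphimS; apply: subsetT.
have oV : #|V| = (p ^ 2)%N.
  by rewrite card_injm ?injm_sdpair1 // cardsT card_mx card_Fp.
have oC : #|C| = q.
  by rewrite card_injm ?injm_sdpair2 ?subsetT.
have abelV : p.-abelem V.
  by rewrite injm_abelem ?injm_sdpair1 ?mx_Fp_abelem.
have tiVC : V :&: C = 1.
  apply/trivgP; rewrite -(im_sdpair_TI to); apply: setIS.
  by apply: morphimS; apply: subsetT.
pose G := (V <*> C)%G.
have defG : V * C = G by rewrite /= norm_joinEr.
have oG : #|G| = (p ^ 2 * q)%N by rewrite -defG TI_cardMg // oV oC.
have nsVG : V <| G by rewrite /normal joing_subl join_subG normG.
exists (sdprod_groupType to), G; split=> //; apply/negP => genG.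
have scaleJ w :
    sdpair1 to w ^ sdpair2 to u = sdpair1 to (FinRing.uval u *: w)%R.
  by rewrite -sdpair_act ?in_setT.
have powerV : {in V, forall v, G \subset 'N(<[v]>)}.
  move=> v Vv; rewrite -defG mulG_subG; apply/andP; split.
    rewrite cents_norm // cent_cycle sub_cent1.
    by rewrite (subsetP (abelem_abelian abelV)).
  rewrite /C /= morphim_cycle ?in_setT // cycle_subG inE -cycleJ cycle_subG.
  have /morphimP[w _ _ ->] := Vv.
  rewrite scaleJ -[FinRing.uval u]natr_Zp scaler_nat -zmodXgE.
  rewrite morphX ?in_setT //.
  exact: mem_cycle.
have u1 : (FinRing.uval u - 1 != 0)%R.
  rewrite subr_eq0; apply: contraTneq (prime_gt1 q_pr) => u1.
  suff -> : q = 1%N by [].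
  by rewrite -ou; apply/eqP; rewrite order_eq1; apply/eqP/val_inj.
have Gc : sdpair2 to u \in G.
  by rewrite (subsetP (joing_subr V C)) // mem_morphim ?in_setT ?cycle_id.
have sVG' : V \subset G^`(1).
  apply/subsetP=> _ /morphimP[w _ _ ->].
  pose z := ((FinRing.uval u - 1)^-1 *: w)%R.
  have Vz : sdpair1 to z \in G.
    by rewrite (subsetP (joing_subl V C)) // mem_morphim ?in_setT.
  suff eqw : [~ sdpair1 to z, sdpair2 to u] = sdpair1 to w.
    by have := mem_commg Vz Gc; rewrite eqw.
  rewrite commgEl scaleJ -morphV ?in_setT // -morphM ?in_setT //.
  congr (sdpair1 to _).
  rewrite zmodMgE zmodVgE -[X in (- X + _)%R]scale1r -scaleNr -scalerDl addrC.
  by rewrite scalerA divff // scale1r.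
have prGV : prime #|G : V|.
  have <- : q = #|G : V|; last by [].
  apply/eqP.
  by rewrite -(eqn_pmul2l (cardG_gt0 V)) Lagrange ?joing_subl // oG oV.
have := gen2_cyclic_prime_index nsVG prGV sVG' powerV genG.
by rewrite (abelem_cyclic abelV) oV pfactorK.
Qed.

Local Close Scope group_scope.

Lemma two_generated_gen2_criterion n :
  odd n -> two_generated_number n -> gen2_criterion n.
Proof.
move=> n_odd gen2; split=> //; first exact: two_generated_cube_free.
move=> p r p_pr r_pr p2n rn; apply/negP => rp1.
have [gT [G [oG]]] := scalar_extension_not_gen2 p_pr r_pr rp1.
apply/negP; rewrite negbK; apply: (two_generated_gen2_dvd gen2).
rewrite oG Gauss_dvd ?p2n // coprimeXl // coprime_sym prime_coprime //.
rewrite dvdn_prime2 //; apply: contraTneq rp1 => ->.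
by rewrite gtnNdvd ?subn_gt0 ?prime_gt1 // ltn_subrL /= prime_gt0.
Qed.

(** * Reading the criterion on a factorisation *)

Lemma prime_dvd_prime_prod (I : finType) (p e : I -> nat) q :
    (forall i, prime (p i)) -> prime q -> q %| \prod_i p i ^ e i ->
  exists i, q = p i.
Proof.
move=> p_pr q_pr; rewrite Euclid_dvd_prod // big_orE => /existsP[i /=].
by rewrite Euclid_dvdX // dvdn_prime2 // => /andP[/eqP-> _]; exists i.
Qed.

Lemma logn_prime_prod (I : finType) (p e : I -> nat) i :
    (forall i, prime (p i)) -> injective p ->
  logn (p i) (\prod_j p j ^ e j) = e i.
Proof.
move=> p_pr p_inj; rewrite (bigD1 i) //=.
have gt0 : 0 < \prod_(j | j != i) p j ^ e j.
  by apply: prodn_cond_gt0 => j _; rewrite expn_gt0 prime_gt0.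
rewrite lognM ?expn_gt0 ?[0 < p i]prime_gt0 //.
rewrite pfactorK // logn_coprime ?addn0 //.
elim/big_ind: _ => [|a b|j neq_ji]; first exact: coprimen1.
  by rewrite coprimeMr => -> ->.
by rewrite coprimeXr // prime_coprime // dvdn_prime2 // (inj_eq p_inj) eq_sym.
Qed.

Theorem theorem1p2 (n k : nat) (p e : 'I_k -> nat)
    (n_gt0 : 0 < n) (n_odd : odd n)
    (p_prime : forall i : 'I_k, prime (p i))
    (p_decr : forall i j : 'I_k, i < j -> p j < p i)
    (e_gt0 : forall i : 'I_k, 0 < e i)
    (n_fact : n = \prod_(i < k) p i ^ e i) :
  two_generated_number n <->
  cube_free n /\
  (forall i j : 'I_k, i < j -> ~~ (p j %| p i - 1) \/ e i = 1).
Proof.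
have lt_p i j : (p j < p i) = (i < j).
  apply/idP/idP; last exact: p_decr.
  apply: contraLR; rewrite -!leqNgt leq_eqVlt.
  by case/orP=> [/eqP/val_inj-> | /p_decr/ltnW].
have p_inj : injective p.
  move=> i j eq_pij; apply/val_inj.
  by case: (ltngtP i j) => // /p_decr; rewrite eq_pij ltnn.
have log_n i : logn (p i) n = e i by rewrite n_fact logn_prime_prod.
have pn i : p i %| n by rewrite -[p i]expn1 pfactor_dvdn // log_n.
split=> [gen2 | [cfn exp1]].
  have [_ cfn actn] := two_generated_gen2_criterion n_odd gen2.
  split=> // i j lt_ij; have [-> | neq1] := eqVneq (e i) 1; [by right | left].
  apply: actn => //; rewrite pfactor_dvdn // log_n.
  by rewrite ltn_neqAle eq_sym neq1 e_gt0.
split=> // gT G oG; apply: gen2_criterion_gen2; rewrite oG; split=> //.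
move=> q r q_pr r_pr q2n rn.
have qn : q %| n by apply: dvdn_trans q2n; apply: dvdn_exp.
move: (qn) (rn); rewrite {1 2}n_fact => /prime_dvd_prime_prod[] // i defq.
move=> /prime_dvd_prime_prod[] // j defr.
rewrite {}defq {}defr in q_pr r_pr q2n rn *.
have [dv | //] := boolP (p j %| p i - 1).
have lt_ij : i < j.
  rewrite -lt_p; have := dvdn_leq _ dv.
  rewrite subn_gt0 prime_gt1 // => /(_ isT).
  by move/leq_ltn_trans->; rewrite // ltn_subrL /= prime_gt0.
case: (exp1 _ _ lt_ij) => [/negP//|ei1].
by move: q2n; rewrite pfactor_dvdn // log_n ei1.
Qed.
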